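(* Let $q>2$ be a power of $2$, let $t\in\mathbb{F}_q^*$, and let $f=x+t x^q+x^{2q-1}\in\mathbb{F}_q[x]$. Then $f$ is a permutation polynomial of $\mathbb{F}_{q^2}$ if and only if $\mathrm{Tr}_{q/2}(1/t)=0$.
   Context: $\mathbb{F}_q$ denotes the finite field with $q$ elements, and $\mathrm{Tr}_{q/2}:\mathbb{F}_q\to\mathbb{F}_2$ is the absolute trace map. A polynomial $f$ is a permutation polynomial of $\mathbb{F}_{q^2}$ if the map $x\mapsto f(x)$ is a bijection of $\mathbb{F}_{q^2}$. *)

(* Defs.v *)
From mathcomp Require Export all_boot all_order all_algebra all_field.

Set Implicit Arguments.
Unset Strict Implicit.
Unset Printing Implicit Defensive.

Import GRing.Theory.
Local Open Scope ring_scope.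

(* Absolute trace y + y^2 + y^4 + ... + y^(2^(m-1)) of a finite field F with
   2^m elements.  Its value is returned as an element of F; by [abs_trace2_F2]
   it lies in the prime subfield {0, 1}. *)
Definition abs_trace2 (F : finFieldType) (y : F) : F :=
  \sum_(i < logn 2 #|F|) y ^+ (2 ^ i)%N.

(* The map induced on L by a polynomial f over a subfield F, where iota is the
   embedding of F into L, is a bijection of L. *)
Definition is_permutation_poly (F L : finFieldType) (iota : {rmorphism F -> L})
  (f : {poly F}) : Prop :=
  bijective (fun x : L => (map_poly iota f).[x]).

Definition trinomial (F : finFieldType) (q : nat) (t : F) : {poly F} :=
  'X + t *: 'X^q + 'X^(2 * q - 1)%N.

Lemma abs_trace2_F2 (F : finFieldType) (m : nat) (y : F) :
  #|F| = (2 ^ m)%N -> abs_trace2 y = 0 \/ abs_trace2 y = 1.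
Proof.
move=> cF; have m_gt0 : (0 < m)%N.
  by case: m cF => // cF; have := finNzRing_gt1 F; rewrite cF.
have ch2 : 2%N \in [pchar F] by exact: card_finPcharP cF erefl.
rewrite /abs_trace2 cF pfactorK //; set s := \sum_(i < m) _.
have s2 : s ^+ 2 = s.
  rewrite -(pFrobenius_autE ch2) /s rmorph_sum /=.
  under eq_bigr => i _ do rewrite pFrobenius_autE -exprM -expnSr.
  case: m m_gt0 cF {s} => // m _ cF.
  by rewrite big_ord_recr big_ord_recl /= addrC -cF expf_card expn0 expr1.
have /eqP : s * (s - 1) = 0 by rewrite mulrBr mulr1 -expr2 s2 subrr.
by rewrite mulf_eq0 subr_eq0 => /orP[] /eqP ->; [left | right].
Qed.

(* Main.v *)
Require Import Defs.
From mathcomp Require Import all_boot all_order all_algebra all_field.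
From mathcomp Require Import ring zify.

Set Implicit Arguments.
Unset Strict Implicit.
Unset Printing Implicit Defensive.

Import GRing.Theory.
Local Open Scope ring_scope.

(** For [x != 0] the product [x f(x) = x^2 + t x x^q + x^(2q)] lies in F_q, and
    [f(c x) = c f(x)] for [c] in F_q.  Hence [f(x) = f(y) != 0] forces [x / y] to
    be in F_q and then to equal [1], so [f] permutes F_(q^2) iff it has no nonzero
    zero.  Such zeros correspond, through [u = x^(q-1)], to the roots of
    [u^2 + t u + 1] with [u^(q+1) = 1]; putting [u = t v] gives the Artin-Schreier
    equation [v^2 + v = 1 / t^2], for which [v^q + v = Tr(1/t)].  Trace [0] forces
    [u = 1], which is not a root; trace [1] makes the two roots conjugate over
    F_q, so that their product [1] is the norm [u^(q+1)]. *)

(** The length [n] is explicit so that the trace of F_q can be computed inside [L], where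
    [abs_trace2] would have twice as many terms. *)
Definition trace2_sum (R : nzRingType) (n : nat) (y : R) : R :=
  \sum_(i < n) y ^+ (2 ^ i)%N.

Lemma exprD_pchar2 (R : comNzRingType) (n : nat) (x y : R) :
  2%N \in [pchar R] ->
  (x + y) ^+ (2 ^ n)%N = x ^+ (2 ^ n)%N + y ^+ (2 ^ n)%N.
Proof. by move=> ch2; rewrite exprDn_pchar // pnatX pnatE // ch2. Qed.

Lemma trace2_sumD (R : comNzRingType) (n : nat) (x y : R) :
  2%N \in [pchar R] ->
  trace2_sum n (x + y) = trace2_sum n x + trace2_sum n y.
Proof.
move=> ch2; rewrite /trace2_sum -big_split /=.
by apply: eq_bigr => i _; rewrite exprD_pchar2.
Qed.

Lemma trace2_sumX2 (R : comNzRingType) (n : nat) (y : R) :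
  2%N \in [pchar R] -> trace2_sum n (y ^+ 2) = trace2_sum n y ^+ 2.
Proof.
move=> ch2; rewrite -(pFrobenius_autE ch2 (trace2_sum n y)) rmorph_sum /=.
by apply: eq_bigr => i _; rewrite pFrobenius_autE -!exprM mulnC.
Qed.

Lemma trace2_sumS (R : nzRingType) (n : nat) (y : R) :
  trace2_sum n.+1 y = trace2_sum n y + y ^+ (2 ^ n)%N.
Proof. by rewrite /trace2_sum big_ord_recr. Qed.

(** The sum telescopes in characteristic 2. *)
Lemma trace2_sum_artin_schreier (R : comNzRingType) (n : nat) (v : R) :
  2%N \in [pchar R] -> trace2_sum n (v ^+ 2 + v) = v ^+ (2 ^ n)%N + v.
Proof.
move=> ch2; elim: n => [|n IHn].
  by rewrite /trace2_sum big_ord0 expr1 addrr_pchar2.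
rewrite trace2_sumS IHn exprD_pchar2 // -exprM -expnS.
by rewrite [X in _ + X = _]addrC addrACA addrr_pchar2 // add0r addrC.
Qed.

(* The witness is that of additive Hilbert 90, applied to the element [c] of
   trace [1]. *)
Lemma artin_schreier_solution (R : comNzRingType) (n : nat) (a c : R) :
  2%N \in [pchar R] -> trace2_sum n a = 0 -> trace2_sum n c = 1 ->
  c ^+ (2 ^ n)%N = c -> exists v, v ^+ 2 + v = a.
Proof.
move=> ch2 Ta Tc cn.
pose v m := \sum_(j < m) trace2_sum j a * c ^+ (2 ^ j)%N.
(* At [m = n] the first term vanishes and [c + c ^+ (2 ^ n)] cancels, which leaves [a]. *)
have vE m : v m ^+ 2 + v m = trace2_sum m a * c ^+ (2 ^ m)%N
    + a * (trace2_sum m c + c + c ^+ (2 ^ m)%N).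
  elim: m => [|m IHm].
    rewrite /v /trace2_sum !big_ord0 expr1 add0r addrr_pchar2 //.
    by rewrite expr0n /=; ring.
  have -> : v m.+1 = v m + trace2_sum m a * c ^+ (2 ^ m)%N.
    by rewrite /v big_ord_recr.
  have sqD (x y : R) : (x + y) ^+ 2 = x ^+ 2 + y ^+ 2 := exprD_pchar2 1 x y ch2.
  have Ta2 : trace2_sum m.+1 a = trace2_sum m a ^+ 2 + a.
    have := trace2_sum_artin_schreier m a ch2.
    rewrite trace2_sumD // trace2_sumX2 // trace2_sumS => H.
    have -> : trace2_sum m a ^+ 2 = a ^+ (2 ^ m)%N + a - trace2_sum m a.
      by rewrite -H addrK.
    by rewrite oppr_pchar2 // addrAC -[_ + a + a]addrA addrr_pchar2 // addr0 addrC.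
  rewrite sqD addrACA IHm Ta2 (trace2_sumS m c) exprMn -exprM -expnSr.
  set s := trace2_sum m a; set d := c ^+ (2 ^ m)%N; set e := c ^+ (2 ^ m.+1)%N.
  have two0 : 2%:R = 0 :> R by apply/eqP; case/andP: ch2.
  (* Collecting the terms that vanish in characteristic 2 into a multiple of 2 gives an identity
     valid in every commutative ring. *)
  have -> : s * d + a * (trace2_sum m c + c + d) + (s ^+ 2 * e + s * d) =
      (s ^+ 2 + a) * e + a * (trace2_sum m c + d + c + e)
      + 2%:R * (s * d - a * e) by ring.
  by rewrite two0 mul0r addr0.
exists (v n); rewrite vE Ta cn Tc mul0r add0r.
by rewrite -addrA addrr_pchar2 // addr0 mulr1.
Qed.

(** Otherwise ['X^q - 'X], of degree [q], would have more than [q] roots. *)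
Lemma exists_expr_neq (L : finFieldType) (q : nat) :
  (1 < q)%N -> (q < #|L|)%N -> exists z : L, z ^+ q != z.
Proof.
move=> q_gt1 q_ltL; apply/existsP; apply: contraLR q_ltL => /existsPn qE.
have szp : size ('X^q - 'X : {poly L}) = q.+1.
  by rewrite size_polyDl size_polyXn // size_polyN size_polyX ltnS.
rewrite -leqNgt -ltnS -szp cardE; apply: max_poly_roots (enum_uniq _).
  by rewrite -size_poly_eq0 szp.
by apply/allP => z _; rewrite /root !hornerE subr_eq0; apply/negPn/qE.
Qed.

Lemma trinomial_map_homogeneous (L : fieldType) (q : nat) (s c x : L) :
  (0 < q)%N -> c ^+ q = c ->
  c * x + s * (c * x) ^+ q + (c * x) ^+ (2 * q - 1)%N =
  c * (x + s * x ^+ q + x ^+ (2 * q - 1)%N).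
Proof.
move=> q_gt0 cq; have -> : (2 * q - 1 = q + q.-1)%N by case: q q_gt0 {cq} => // n _; lia.
(* No division by [c] occurs: c^q c^(q-1) = c c^(q-1) = c^q = c, so [c = 0] is covered. *)
have cq1 : c ^+ (q + q.-1)%N = c.
  by rewrite exprD cq -exprS prednK.
by rewrite !exprMn cq cq1; ring.
Qed.

Lemma trinomial_map_mulx (L : fieldType) (q : nat) (s x : L) :
  (0 < q)%N ->
  x * (x + s * x ^+ q + x ^+ (2 * q - 1)%N) =
  x ^+ 2 + s * x * x ^+ q + (x ^+ q) ^+ 2.
Proof.
case: q => // n _; have -> : (2 * n.+1 - 1 = n.+1 + n)%N by lia.
by rewrite exprD !exprS expr0; ring.
Qed.

Lemma trinomial_map_injP (L : finFieldType) (q k : nat) (s : L) :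
  q = (2 ^ k)%N -> 2%N \in [pchar L] -> #|L| = (q ^ 2)%N -> s ^+ q = s ->
  let f x := x + s * x ^+ q + x ^+ (2 * q - 1)%N in
  injective f <-> (forall x, f x = 0 -> x = 0).
Proof.
move=> hq ch2 cL sq f; have q_gt0 : (0 < q)%N by rewrite hq expn_gt0.
have fM c x : c ^+ q = c -> f (c * x) = c * f x.
  exact: trinomial_map_homogeneous.
have f0 : f 0 = 0 by have := fM 0 0; rewrite !mul0r expr0n eqn0Ngt q_gt0 => ->.
split=> [inj x fx0 | f_eq0 x y fxy]; first by apply: inj; rewrite fx0 f0.
have [y0 | y_neq0] := eqVneq y 0; first by rewrite y0 in fxy *; apply: f_eq0; rewrite fxy.
have fy_neq0 : f y != 0 by apply: contraNneq y_neq0 => /f_eq0->.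
have norm_fix z : (z * f z) ^+ q = z * f z.
  have qD a b : (a + b) ^+ q = a ^+ q + b ^+ q :> L by rewrite hq exprD_pchar2.
  rewrite /f trinomial_map_mulx // !qD.
  have zqq : (z ^+ q) ^+ q = z by rewrite -exprM mulnn -cL expf_card.
  by rewrite !(exprAC _ 2 q) (exprMn q (s * z)) (exprMn q s) sq zqq; ring.
(* This is [x / y], since [f x = f y], written as a quotient of elements of F_q. *)
pose c := (x * f x) / (y * f y).
have cq : c ^+ q = c by rewrite /c expr_div_n !norm_fix.
have xE : x = c * y by rewrite /c fxy -mulf_div divff // mulr1 divfK.
have := fM c y cq; rewrite -xE fxy -{1}[f y]mul1r => /(mulIf fy_neq0) c1.
by rewrite xE -c1 mul1r.
Qed.

Lemma trinomial_map_no_zero (L : finFieldType) (q k : nat) (s : L) :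
  q = (2 ^ k)%N -> 2%N \in [pchar L] -> #|L| = (q ^ 2)%N ->
  s != 0 -> s ^+ q = s -> trace2_sum k s^-1 = 0 ->
  forall x, x + s * x ^+ q + x ^+ (2 * q - 1)%N = 0 -> x = 0.
Proof.
move=> hq ch2 cL s_neq0 sq Ts x fx0; apply/eqP; apply: contraT => x_neq0.
have q_gt0 : (0 < q)%N by rewrite hq expn_gt0.
have := trinomial_map_mulx s x q_gt0; rewrite fx0 mulr0 => /esym hx.
pose u := x ^+ q / x.
have uq : u ^+ q * u = 1.
  rewrite /u expr_div_n -exprM mulnn -cL expf_card; field.
  by rewrite x_neq0 expf_neq0.
have hu : u ^+ 2 + s * u + 1 = 0.
  have -> : u ^+ 2 + s * u + 1 =
      (x ^+ 2 + s * x * x ^+ q + (x ^+ q) ^+ 2) / x ^+ 2 by rewrite /u; field.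
  by rewrite hx mul0r.
have hv : (u / s) ^+ 2 + u / s = s^-1 ^+ 2.
  have -> : (u / s) ^+ 2 + u / s = (u ^+ 2 + s * u + 1) / s ^+ 2 - s^-1 ^+ 2 by field.
  by rewrite hu mul0r add0r oppr_pchar2.
have := trace2_sum_artin_schreier k (u / s) ch2.
rewrite hv trace2_sumX2 // Ts expr0n /= -hq => /esym/eqP.
rewrite addr_eq0 oppr_pchar2 // => /eqP vq.
have uqE : u ^+ q = u.
  move: vq; rewrite expr_div_n.
  by rewrite sq => /(mulIf (invr_neq0 s_neq0)).
(* With [u * u = 1] the quadratic reduces to [s * u = 0], so [u = 0], a contradiction. *)
move: uq hu; rewrite uqE => uu; rewrite expr2 uu addrAC addrr_pchar2 // add0r.
by move/eqP; rewrite mulf_eq0 (negPf s_neq0) /= => /eqP u0; move/eqP: uu;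
  rewrite u0 mul0r eq_sym oner_eq0.
Qed.

(** For [z] outside F_q, dividing [z] by its nonzero relative trace [z ^+ q + z] gives an element of
    relative trace 1. *)
Lemma exists_conjugate_add1 (L : finFieldType) (q k : nat) :
  q = (2 ^ k)%N -> (1 < q)%N -> 2%N \in [pchar L] -> #|L| = (q ^ 2)%N ->
  exists w : L, w ^+ q = w + 1.
Proof.
move=> hq q_gt1 ch2 cL.
have [|z zq] := @exists_expr_neq L q q_gt1; first by rewrite cL (ltn_exp2l 1).
have d_neq0 : z ^+ q + z != 0 by rewrite addr_eq0 oppr_pchar2.
have zqq : (z ^+ q) ^+ q = z by rewrite -exprM mulnn -cL expf_card.
have dq : (z ^+ q + z) ^+ q = z ^+ q + z.
  have := exprD_pchar2 k (z ^+ q) z ch2; rewrite -hq => ->.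
  by rewrite zqq addrC.
exists (z / (z ^+ q + z)); rewrite expr_div_n dq -[1](divff d_neq0) -mulrDl.
by rewrite addrCA addrr_pchar2 // addr0.
Qed.

Lemma trinomial_map_zero (L : finFieldType) (q k : nat) (s : L) :
  q = (2 ^ k)%N -> (1 < q)%N -> 2%N \in [pchar L] -> #|L| = (q ^ 2)%N ->
  s != 0 -> s ^+ q = s -> trace2_sum k s^-1 = 1 ->
  exists2 x, x != 0 & x + s * x ^+ q + x ^+ (2 * q - 1)%N = 0.
Proof.
move=> hq q_gt1 ch2 cL s_neq0 sq Ts.
have [w wq] := exists_conjugate_add1 hq q_gt1 ch2 cL.
have Tc : trace2_sum k (s^-1 ^+ 2) = 1 by rewrite trace2_sumX2 // Ts expr1n.
have Tw : trace2_sum k (w ^+ 2 + w) = 1.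
  by rewrite trace2_sum_artin_schreier // -hq wq addrAC addrr_pchar2 // add0r.
(* Adding [w ^+ 2 + w], of trace 1, makes the right-hand side have trace 0; adding [w] to the
   solution undoes this. The element of trace 1 that the lemma requires is [s^-1 ^+ 2] itself. *)
have [||v0 v0E] := @artin_schreier_solution L k
    (s^-1 ^+ 2 + (w ^+ 2 + w)) (s^-1 ^+ 2) ch2 _ Tc.
- by rewrite trace2_sumD // Tc Tw addrr_pchar2.
- by rewrite -hq exprAC [s^-1 ^+ q]exprVn sq.
pose v := v0 + w.
have vE : v ^+ 2 + v = s^-1 ^+ 2.
  by rewrite /v (exprD_pchar2 1) // addrACA v0E -addrA addrr_pchar2 // addr0.
have vq : v ^+ q = v + 1.
  have := trace2_sum_artin_schreier k v ch2; rewrite vE Tc -hq => ->.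
  by rewrite addrCA addrr_pchar2 // addr0.
pose u := s * v.
have uq : u ^+ q = u + s by rewrite /u exprMn sq vq mulrDr mulr1.
have uu : u * (u + s) = 1.
  have -> : u * (u + s) = s ^+ 2 * (v ^+ 2 + v) by rewrite /u; ring.
  by rewrite vE; field.
(* Hilbert 90 for [u] of norm 1: [x] is [1 + u ^+ q], so x^q = 1 + u = u x. *)
pose x := 1 + (u + s).
have xq : x ^+ q = u * x.
  have qD a b : (a + b) ^+ q = a ^+ q + b ^+ q :> L by rewrite hq exprD_pchar2.
  rewrite /x !qD expr1n uq sq -addrA addrr_pchar2 //.
  by rewrite addr0 mulrDr mulr1 uu addrC.
have x_neq0 : x != 0.
  rewrite /x addr_eq0 oppr_pchar2 //; apply: contraNneq s_neq0 => us.
  have u1 : u = 1 by rewrite -uu -us mulr1.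
  by apply/eqP/(addrI u); rewrite -us addr0 u1.
exists x => //; apply: (mulfI x_neq0).
rewrite trinomial_map_mulx ?(ltnW q_gt1) // xq mulr0.
have -> : x ^+ 2 + s * x * (u * x) + (u * x) ^+ 2 = x ^+ 2 * (1 + u * (u + s)).
  by ring.
by rewrite uu addrr_pchar2 // mulr0.
Qed.

Theorem theorem1p2 (q k : nat) (F L : finFieldType) (iota : {rmorphism F -> L})
    (hq : q = (2 ^ k)%N) (q_gt2 : (2 < q)%N)
    (cardF : #|F| = q) (cardL : #|L| = (q ^ 2)%N)
    (t : F) (t_neq0 : t != 0) :
  is_permutation_poly iota (trinomial q t) <-> abs_trace2 (1 / t) = 0.
Proof.
have q_gt1 := ltnW q_gt2.
have chF : 2%N \in [pchar F] by apply: card_finPcharP (etrans cardF hq) erefl.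
have chL : 2%N \in [pchar L] by rewrite (fmorph_pchar iota).
have s_neq0 : iota t != 0 by rewrite fmorph_eq0.
have sq : iota t ^+ q = iota t by rewrite -rmorphXn -cardF expf_card.
(* Since [iota] is injective on {0, 1}, the trace condition can be tested in [L]. *)
have trE : iota (abs_trace2 (1 / t)) = trace2_sum k (iota t)^-1.
  rewrite /abs_trace2 cardF hq pfactorK // rmorph_sum div1r /=.
  by apply: eq_bigr => i _; rewrite rmorphXn /= fmorphV.
have fE x : (map_poly iota (trinomial q t)).[x] =
    x + iota t * x ^+ q + x ^+ (2 * q - 1)%N.
  by rewrite /trinomial !rmorphD /= map_polyZ !map_polyXn map_polyX !hornerE.
have injP := trinomial_map_injP hq chL cardL sq.
split=> [perm | tr0].
  have [// | tr1] := abs_trace2_F2 (1 / t) (etrans cardF hq).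
  have [|x x_neq0 fx0] := trinomial_map_zero hq q_gt1 chL cardL s_neq0 sq.
    by rewrite -trE tr1 rmorph1.
  case/eqP: x_neq0; apply: injP.1 fx0; apply: eq_inj (bij_inj perm) _ => y.
  exact: fE.
apply: injF_bij; apply: eq_inj (injP.2 _) (fsym fE).
apply: trinomial_map_no_zero hq chL cardL s_neq0 sq _.
by rewrite -trE tr0 rmorph0.
Qed.
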